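(* If $V$ is a linearly compact vector space over a discrete field $\mathbb K$ and $\phi\colon V\to V$ is a continuous endomorphism, then $\mathrm{ent}(\phi)=0$. In particular, if $V$ is a finite-dimensional vector space (with the discrete topology), then $\mathrm{ent}(\phi)=0$ for every endomorphism $\phi$ of $V$.
   Context: $\mathbb K$ is an arbitrary field endowed with the discrete topology. A topological vector space over $\mathbb K$ is linearly topologized if it is Hausdorff and has a neighborhood basis at $0$ consisting of linear subspaces (a finite-dimensional linearly topologized vector space is necessarily discrete). A linear variety of $V$ is a coset $v+W$ of a linear subspace $W$; it is closed (open) if $W$ is closed (open). A linearly topologized vector space is linearly compact if every collection of closed linear varieties with the finite intersection property has non-empty intersection. A linearly topologized vector space is locally linearly compact (l.l.c.) if it has an open linear subspace that is linearly compact; $\mathcal B(V)$ denotes the family of all linearly compact open linear subspaces of $V$. ''Endomorphism'' means linear endomorphism. For a continuous endomorphism $\phi$ of an l.l.c. space $V$, $U\in\mathcal B(V)$ and a positive integer $n$, let $T_n(\phi,U)=U+\phi U+\dots+\phi^{n-1}U$. Define $H(\phi,U)=\lim_{n\to\infty}\frac1n\dim\frac{T_n(\phi,U)}{U}$ (the limit exists) and $\mathrm{ent}(\phi)=\sup\{H(\phi,U)\mid U\in\mathcal B(V)\}\in\mathbb N\cup\{\infty\}$. *)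

(* Defs.v *)
From HB Require Import structures.
From mathcomp Require Import all_boot all_order all_algebra.
From mathcomp Require Import all_classical all_reals topology.

Set Implicit Arguments.
Unset Strict Implicit.
Unset Printing Implicit Defensive.

Import Order.TTheory GRing.Theory Num.Theory.

Local Open Scope classical_set_scope.
Local Open Scope ring_scope.

Definition linear_subspace (K : fieldType) (V : lmodType K) (W : set V) :=
  GRing.submod_closed (mem W).

(* A Hausdorff topological vector space over the discrete field K, with a
   neighborhood basis at 0 made of linear subspaces.
   The library's topologicalLmodType is restricted to a numDomainType of scalars
   carrying its norm topology, and it reserves the join of Topological and
   GRing.Lmodule for such scalars. This is why the structure below is declared
   before the rest of MathComp-Analysis is loaded. *)
HB.mixin Record isLinearlyTopologized (K : fieldType) V
    & Topological V & GRing.Lmodule K V := {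
  lintop_add_continuous : continuous (fun z : V * V => z.1 + z.2) ;
  lintop_scale_continuous :
    continuous (fun z : discrete_topology K * V => (z.1 : K) *: z.2) ;
  lintop_hausdorff : hausdorff_space V ;
  lintop_basis0 : forall A : set V, nbhs (0 : V) A ->
    exists W : set V, [/\ linear_subspace W, nbhs (0 : V) W & W `<=` A]
}.

#[short(type="linTopType")]
HB.structure Definition LinearlyTopologized (K : fieldType) :=
  {V of Topological V & GRing.Lmodule K V & isLinearlyTopologized K V}.

From mathcomp Require Import all_analysis.
Import numFieldNormedType.Exports.

Section topologicalZmodType_of_linTopType.
Context {K : fieldType} {V : linTopType K}.

Let sub_cts : continuous (fun z : V * V => z.1 - z.2).
Proof.
have opp_cts : continuous (-%R : V -> V).
  move=> y; rewrite (_ : -%R = (fun z : V => (- 1 : K) *: z)); last first.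
    by apply/funext => z; rewrite scaleN1r.
  apply: (@continuous_comp V (discrete_topology K * V)%type V
    (fun z => (- 1, z)) (fun z => (z.1 : K) *: z.2)).
    apply: (@cvg_pair _ _ _ _ (nbhs (- 1 : discrete_topology K))).
      exact: cvg_cst.
    exact: cvg_id.
  exact: lintop_scale_continuous.
move=> x; apply: (@continuous_comp _ (V * V)%type V
  (fun z : V * V => (z.1, - z.2)) (fun z => z.1 + z.2)).
  apply: cvg_pair; first exact: cvg_fst.
  by apply: continuous_comp; [exact: cvg_snd|exact: opp_cts].
exact: lintop_add_continuous.
Qed.

(* Only proofs are inherited here, no operations. *)
#[non_forgetful_inheritance]
HB.instance Definition _ :=
  PreTopologicalNmodule_isTopologicalZmodule.Build V sub_cts.

End topologicalZmodType_of_linTopType.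

Section linear_compactness.
Context {K : fieldType} {V : linTopType K}.
Implicit Types A L U : set V.

(* Cosets v + W with v in A, and W a linear subspace of A that is closed for
   the topology induced by V on A. *)
Definition closed_linear_variety A L := exists (v : V) (W : set V),
  [/\ A v, linear_subspace W, exists2 C : set V, closed C & W = A `&` C
    & L = [set v + w | w in W]].

(* A is meant to be a linear subspace of V, with the induced topology. *)
Definition linearly_compact A := forall F : set (set V),
  F `<=` closed_linear_variety A -> finI F id ->
  \bigcap_(L in F) L !=set0.

Definition lc_open_subspaces : set (set V) :=
  [set U | [/\ linear_subspace U, open U & linearly_compact U]].

End linear_compactness.
Arguments lc_open_subspaces {K} V.

Definition locally_linearly_compact (K : fieldType) (V : linTopType K) :=
  lc_open_subspaces V !=set0.

Lemma linear_subspaceT (K : fieldType) (V : lmodType K) :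
  linear_subspace [set: V].
Proof. by split=> [|a u v _ _]; exact: in_setT. Qed.

Lemma linearly_compact_llc (K : fieldType) (V : linTopType K) :
  linearly_compact [set: V] -> locally_linearly_compact V.
Proof.
by exists setT; split => //; [exact: linear_subspaceT|exact: openT].
Qed.

Section quotient_dimension.
Context {K : fieldType} {V : lmodType K}.
Implicit Types U W : set V.

(* The cosets e_i + U form a basis of the quotient space W / U. *)
Definition quotient_basis W U n (e : 'I_n -> V) :=
  [/\ forall i, W (e i),
      forall a : 'I_n -> K, U (\sum_(i < n) a i *: e i) -> forall i, a i = 0
    & forall w, W w -> exists a : 'I_n -> K, U (w - \sum_(i < n) a i *: e i)].

(* dim W / U : the size of its finite bases, +oo if it has none
   (the infimum of the empty set). *)
Definition quotient_dim (R : realType) W U : \bar R :=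
  ereal_inf [set n%:R%:E |
    n in [set n | exists e : 'I_n -> V, quotient_basis W U e]].

End quotient_dimension.

Section entropy.
Context {K : fieldType} {V : linTopType K}.
Implicit Types (phi : {linear V -> V}) (U : set V).

(* U + phi U + ... + phi^(n-1) U *)
Definition trajectory n phi U : set V :=
  [set \sum_(i < n) iter i phi (u i) |
    u in [set u : 'I_n -> V | forall i, U (u i)]].

(* The sequence is indexed so that only the positive integers n.+1 occur. *)
Definition entropy_at (R : realType) phi U : \bar R :=
  limn (fun n => (n.+1%:R^-1)%:E * quotient_dim R (trajectory n.+1 phi U) U)%E.

Definition ent (R : realType) phi : \bar R :=
  ereal_sup [set entropy_at R phi U | U in lc_open_subspaces V].

End entropy.

Section discrete_linTop.
Context {K : fieldType} {V : lmodType K}.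

HB.instance Definition _ := GRing.Lmodule.copy (discrete_topology V) V.

Let disc_cts2 (X Y : discreteTopologicalType) (Z : topologicalType)
  (f : X * Y -> Z) : continuous f.
Proof.
case=> x y A fA; exists ([set x], [set y]) => /=.
  by split; exact: discrete_set1.
by case=> a b [/= -> ->]; exact: (nbhs_singleton fA).
Qed.

HB.instance Definition _ :=
  PreTopologicalNmodule_isTopologicalZmodule.Build (discrete_topology V)
    (@disc_cts2 _ _ _ _).

Let disc_hausdorff : hausdorff_space (discrete_topology V).
Proof.
move=> p q /(_ _ _ (discrete_set1 p) (discrete_set1 q)).
by case=> x [/= -> ].
Qed.

Let disc_basis0 (A : set (discrete_topology V)) :
  nbhs (0 : discrete_topology V) A ->
  exists W : set (discrete_topology V),
    [/\ linear_subspace W, nbhs (0 : discrete_topology V) W & W `<=` A].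
Proof.
move=> A0; exists [set 0]; split; last by move=> _ ->; exact: (nbhs_singleton A0).
  split=> [|a u v]; rewrite !inE //= => -> ->.
  by rewrite scaler0 addr0.
exact: discrete_set1.
Qed.

HB.instance Definition _ := isLinearlyTopologized.Build K (discrete_topology V)
  (@disc_cts2 _ _ _ _) (@disc_cts2 _ _ _ _) disc_hausdorff disc_basis0.

End discrete_linTop.

(* Main.v *)
(* An open linear subspace U of a linearly compact space V has finite
   codimension: if e_0, e_1, ... were linearly independent modulo U, the closed
   linear varieties s_n + W_n, where s_n = e_0 + ... + e_(n-1) and W_n is the
   span of U and the e_i with i >= n, would have the finite intersection
   property, whereas a common point would be congruent modulo U to a finite
   combination of the e_i with all coefficients equal to 1. Hence
   dim T_n(phi, U) / U is bounded independently of n, and its quotient by n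
   tends to 0. *)
Require Import Defs.
From mathcomp Require Import all_boot all_order all_algebra finmap.
From mathcomp Require Import all_classical all_reals all_analysis.

Set Implicit Arguments.
Unset Strict Implicit.
Unset Printing Implicit Defensive.

Import Order.TTheory GRing.Theory Num.Theory.
Local Open Scope classical_set_scope.
Local Open Scope ring_scope.

(** * Closure properties of linear subspaces *)

Section linear_subspaces.
Context {K : fieldType} {V : lmodType K} (U : set V).
Hypothesis linU : linear_subspace U.

Lemma linear_subspace0 : U 0.
Proof. by have [+ _] := linU; rewrite inE. Qed.

Lemma linear_subspaceP a u v : U u -> U v -> U (a *: u + v).
Proof. by move=> Uu Uv; have [_ /(_ a u v)] := linU; rewrite !inE; apply. Qed.

Lemma linear_subspaceD u v : U u -> U v -> U (u + v).
Proof. by move=> Uu Uv; rewrite -[u]scale1r; exact: linear_subspaceP. Qed.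

Lemma linear_subspaceZ a u : U u -> U (a *: u).
Proof.
by move=> Uu; rewrite -[_ *: _]addr0; apply: linear_subspaceP linear_subspace0.
Qed.

Lemma linear_subspaceB u v : U u -> U v -> U (u - v).
Proof.
by move=> Uu Uv; rewrite -scaleN1r addrC; exact: linear_subspaceP.
Qed.

Lemma linear_subspace_sum I (r : seq I) (P : pred I) (F : I -> V) :
  (forall i, P i -> U (F i)) -> U (\sum_(i <- r | P i) F i).
Proof.
move=> UF; apply: big_ind => //; first exact: linear_subspace0.
exact: linear_subspaceD.
Qed.

End linear_subspaces.

(** * Independence modulo a subspace and dimension of quotients *)

Section independence_modulo.
Context {K : fieldType} {V : lmodType K}.
Implicit Types U W : set V.

Definition spans_mod U n (f : 'I_n -> V) :=
  forall v, exists a : 'I_n -> K, U (v - \sum_(i < n) a i *: f i).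

Definition free_mod U n (e : 'I_n -> V) :=
  forall a : 'I_n -> K, U (\sum_(i < n) a i *: e i) -> forall i, a i = 0.

(** Exchange bound: the coordinates of the [e i] along [f] modulo [U] form an n by d matrix. If d <
    n, a nonzero row vector in its left kernel yields a nontrivial relation among the [e i] modulo
    [U]. *)
Lemma free_mod_leq_spans_mod U n d (e : 'I_n -> V) (f : 'I_d -> V) :
  linear_subspace U -> free_mod U e -> spans_mod U f -> (n <= d)%N.
Proof.
move=> linU free_e span_f; rewrite leqNgt; apply/negP => lt_dn.
have [A eA] := choice (fun i => span_f (e i)).
pose M : 'M[K]_(n, d) := \matrix_(i, j) A i j.
have : kermx M != 0.
  rewrite -mxrank_eq0 mxrank_ker subn_eq0 -ltnNge.
  by rewrite (leq_ltn_trans _ lt_dn)// rank_leq_col.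
case/rowV0Pn => x /sub_kermxP xM0 /eqP; apply.
apply/rowP => i; rewrite mxE; move: i; apply: free_e.
(* Since [x] kills [M], subtracting the [f]-parts changes nothing, and each remaining term lies in
   [U]. *)
suff -> : \sum_(i < n) x 0 i *: e i =
    \sum_(i < n) x 0 i *: (e i - \sum_(j < d) A i j *: f j).
  apply: (linear_subspace_sum linU) => i _; apply: (linear_subspaceZ linU).
  exact: eA.
under [RHS]eq_bigr do rewrite scalerBr scaler_sumr.
rewrite sumrB exchange_big/= [X in _ - X]big1 ?subr0// => j _.
under eq_bigr do rewrite scalerA.
rewrite -scaler_suml; have := congr1 (fun N : 'rV[K]_d => N 0 j) xM0.
rewrite !mxE => xMj; rewrite (_ : \sum_i _ = 0) ?scale0r// -[RHS]xMj.
by apply: eq_bigr => i _; rewrite mxE.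
Qed.

Lemma free_mod_extend U n (e : 'I_n -> V) w :
  linear_subspace U -> free_mod U e ->
  (forall a : 'I_n -> K, ~ U (w - \sum_(i < n) a i *: e i)) ->
  free_mod U (fun i => oapp e w (unlift ord_max i)).
Proof.
move=> linU free_e wNspan a.
rewrite big_ord_recr/= unlift_none/=.
under eq_bigr => i _.
  rewrite (_ : widen_ord _ i = lift ord_max i); last first.
    by apply: val_inj; rewrite /= /bump leqNgt ltn_ord.
  rewrite liftK /=; over.
move=> Ua; have a_max : a ord_max = 0.
  apply/eqP/negPn/negP => aN0.
  (* Solve the relation for [w], dividing by its nonzero coefficient. *)
  apply: (wNspan (fun i => - ((a ord_max)^-1 * a (lift ord_max i)))).
  have := linear_subspaceZ linU (a ord_max)^-1 Ua.
  rewrite scalerDr scalerA mulVf// scale1r addrC scaler_sumr -sumrN.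
  by under [in X in _ -> X]eq_bigr do rewrite scaleNr opprK -scalerA.
move: Ua; rewrite a_max scale0r addr0 => /free_e a0 i.
by case: (unliftP ord_max i) => [j ->|->//]; exact: a0.
Qed.

Lemma quotient_basis_exists U W d (f : 'I_d -> V) :
  linear_subspace U -> spans_mod U f ->
  exists n (e : 'I_n -> V), (n <= d)%N /\ quotient_basis W U e.
Proof.
move=> linU span_f.
(* Sizes of families in [W] independent modulo [U] are bounded by [d]; a family of maximal size
   spans, as otherwise it could be extended. *)
pose P n := `[< exists2 e : 'I_n -> V, forall i, W (e i) & free_mod U e >].
have P0 : exists n, P n.
  by exists 0%N; apply/asboolP; exists (fun=> 0) => [[]|a _ []].
have Pd n : P n -> (n <= d)%N.
  by move=> /asboolP[e _ free_e]; exact: free_mod_leq_spans_mod free_e span_f.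
have [n /asboolP[e We free_e] max_n] := ex_maxnP P0 Pd.
exists n, e; split; first exact: free_mod_leq_spans_mod free_e span_f.
split=> // w Ww; apply: contrapT => /forallNP wNspan.
suff /max_n : P n.+1 by rewrite ltnn.
apply/asboolP; eexists; last exact: (free_mod_extend linU free_e wNspan).
by move=> i /=; case: (unlift ord_max i).
Qed.

Lemma quotient_dim_ge0 (R : realType) W U : (0 <= quotient_dim R W U)%E.
Proof. by apply: le_ereal_inf_tmp => _ [n _ <-]; rewrite lee_fin. Qed.

Lemma quotient_dim_le (R : realType) W U d (f : 'I_d -> V) :
  linear_subspace U -> spans_mod U f -> (quotient_dim R W U <= d%:R%:E)%E.
Proof.
move=> linU /(quotient_basis_exists W linU)[n [e [le_nd basis_e]]].
apply: (@le_trans _ _ n%:R%:E); last by rewrite lee_fin ler_nat.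
by apply: ereal_inf_lbound; exists n => //; exists e.
Qed.

End independence_modulo.

(** * Expansions along an infinite sequence independent modulo [U] *)

Section infinite_codimension.
Context {K : fieldType} {V : lmodType K} (U : set V).
Hypothesis linU : linear_subspace U.

(** Asking for the congruence at every large [m] lets expansions of different lengths be combined
    termwise; when [e] is free modulo [U], it also forces [c] to vanish from [M] on. *)
Definition expands (e : nat -> V) (c : nat -> K) (v : V) :=
  exists M, forall m, (M <= m)%N -> U (v - \sum_(i < m) c i *: e i).

Lemma expandsP e a c d u v : expands e c u -> expands e d v ->
  expands e (fun i => a * c i + d i) (a *: u + v).
Proof.
move=> [M uM] [N vN]; exists (maxn M N) => m; rewrite geq_max => /andP[Mm Nm].
have := linear_subspaceP linU a (uM _ Mm) (vN _ Nm).
congr (U _); under [in RHS]eq_bigr do rewrite scalerDl -scalerA.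
by rewrite big_split/= -scaler_sumr scalerBr opprD addrACA.
Qed.

Lemma expands0 e v : U v -> expands e (fun=> 0) v.
Proof.
by move=> Uv; exists 0%N => m _; rewrite big1 ?subr0// => i _; rewrite scale0r.
Qed.

Lemma expands_sum e N (c : nat -> K) :
  expands e (fun i => if (i < N)%N then c i else 0) (\sum_(i < N) c i *: e i).
Proof.
exists N => m Nm; rewrite (big_ord_widen _ (fun i => c i *: e i) Nm).
rewrite big_mkcond -sumrB big1 => [|i _]; first exact: linear_subspace0 linU.
by case: ifP; rewrite ?scale0r subrr.
Qed.

(** The form of independence that a greedy choice of vectors produces; [free_seq_mod_coef0] recovers
    the usual one. *)
Definition free_seq_mod (e : nat -> V) :=
  forall n (a : nat -> K), ~ U (e n - \sum_(i < n) a i *: e i).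

Lemma free_seq_mod_coef0 e n (c : nat -> K) : free_seq_mod e ->
  U (\sum_(i < n) c i *: e i) -> forall i, (i < n)%N -> c i = 0.
Proof.
move=> free_e; elim: n => // n IHn; rewrite big_ord_recr/= => Uc.
have cn0 : c n = 0.
  apply/eqP/negPn/negP => cnN0.
  apply: (free_e n (fun i => - ((c n)^-1 * c i))).
  have := linear_subspaceZ linU (c n)^-1 Uc.
  rewrite scalerDr scalerA mulVf// scale1r addrC scaler_sumr -sumrN.
  by under [in X in _ -> X]eq_bigr do rewrite scaleNr opprK -scalerA.
move: Uc; rewrite cn0 scale0r addr0 => /IHn c0 i.
by rewrite ltnS leq_eqVlt => /predU1P[->//|]; exact: c0.
Qed.

Lemma expands_unique e c d v : free_seq_mod e ->
  expands e c v -> expands e d v -> forall i, c i = d i.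
Proof.
move=> free_e vc vd i; apply/eqP; rewrite -subr_eq0; apply/eqP.
have [M] := expandsP (-1) vd vc.
(* The vector 0 expands with coefficients c - d; this length is past the threshold [M] and includes
   the index [i]. *)
move=> /(_ (maxn M i.+1) (leq_maxl _ _)).
rewrite scaleN1r addNr sub0r => /(linear_subspaceZ linU (-1)).
rewrite scaleN1r opprK.
move=> /(free_seq_mod_coef0 (c := fun i => -1 * d i + c i) free_e)/(_ i).
by rewrite leq_maxr mulN1r addrC; apply.
Qed.

Lemma expands_eventually0 e c v : free_seq_mod e -> expands e c v ->
  exists N, c N = 0.
Proof.
move=> free_e [M vM]; exists M.
(* Two consecutive partial sums differ by [c M *: e M], which therefore lies in [U]. *)
have := linear_subspaceB linU (vM _ (leqnn M)) (vM _ (leqnSn M)).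
rewrite opprB addrC addrA subrK big_ord_recr/= addrAC subrr add0r => Uc.
apply/eqP/negPn/negP => cN0; apply: (free_e M (fun=> 0)).
rewrite big1 ?subr0 => [|i _]; last by rewrite scale0r.
by have := linear_subspaceZ linU (c M)^-1 Uc; rewrite scalerA mulVf// scale1r.
Qed.

Lemma free_seq_mod_exists :
  (forall n (f : 'I_n -> V), ~ spans_mod U f) -> exists e, free_seq_mod e.
Proof.
move=> Nspan.
have /choice[g gP] : forall s : seq V, exists v, forall a : nat -> K,
    ~ U (v - \sum_(i < size s) a i *: s`_i).
  move=> s; have /existsNP[v /forallNP vP] :=
    Nspan _ (fun i : 'I_(size s) => s`_i).
  by exists v => a; exact: (vP (fun i => a i)).
(* [s n] lists the first [n] chosen vectors, and [g] picks a vector outside their span modulo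
   [U]. *)
pose s n := iter n (fun s => rcons s (g s)) [::].
have size_s n : size (s n) = n by elim: n => //= n IH; rewrite size_rcons IH.
have nth_s n i : (i < n)%N -> (s n)`_i = g (s i).
  elim: n => // n IHn; rewrite ltnS leq_eqVlt /= nth_rcons size_s.
  by move=> /predU1P[->|lt_in]; rewrite ?ltnn ?eqxx// lt_in IHn.
exists (g \o s) => n a; have := gP (s n) a; rewrite size_s.
congr (~ U (_ - _)).
by apply: eq_bigr => i _; rewrite nth_s.
Qed.

End infinite_codimension.

(** * Open subspaces of a linearly compact space *)

Lemma open_sub_closed {K : fieldType} {V : linTopType K} (U W : set V) :
  linear_subspace U -> open U -> linear_subspace W -> U `<=` W -> closed W.
Proof.
move=> linU openU linW UW v vW.
(* Some neighborhood of [v] has all its differences with [v] in [U]; it meets [W], so [v] differs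
   from a point of [W] by an element of [U], hence of [W]. *)
have : nbhs (v - v) U.
  by rewrite subrr; apply: open_nbhs_nbhs; split => //; exact: linear_subspace0.
move=> /(lintop_add_continuous (v, - v)) [[A B] /= [vA vB] ABU].
have [w [Ww Aw]] := vW _ vA.
have /UW Wwv : U (w - v).
  by apply: (ABU (w, - v)); split => //=; exact: nbhs_singleton.
by rewrite -[v](subKr w); exact: linear_subspaceB.
Qed.

Lemma linearly_compact_spans_mod {K : fieldType} {V : linTopType K}
    (U : set V) : linearly_compact [set: V] -> linear_subspace U -> open U ->
  exists n (f : 'I_n -> V), spans_mod U f.
Proof.
move=> Vcpt linU openU; apply: contrapT => NspanU.
have [e free_e] : exists e, free_seq_mod U e.
  by apply: free_seq_mod_exists => n f span_f; apply: NspanU; exists n, f.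
(* Describing the span of [U] and the later [e i] by vanishing coefficients turns membership in
   [L n] into having the first [n] coefficients equal to 1. *)
pose W n : set V := [set v | exists2 c : nat -> K,
  forall i, (i < n)%N -> c i = 0 & expands U e c v].
pose s n : V := \sum_(i < n) 1 *: e i.
pose L n := [set s n + w | w in W n].
have linW n : linear_subspace (W n).
  split=> [|a u v]; rewrite !inE.
    by exists (fun=> 0) => //; apply: expands0; exact: linear_subspace0.
  move=> [c c0 uc] [d d0 vd]; exists (fun i => a * c i + d i).
    by move=> i ltin; rewrite c0// d0// mulr0 addr0.
  exact: expandsP.
have LP v n : L n v -> exists2 c : nat -> K,
    forall i, (i < n)%N -> c i = 1 & expands U e c v.
  move=> [w [c c0 wc] <-].
  have := expandsP linU 1 (expands_sum linU e n (fun=> 1)) wc.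
  rewrite scale1r => vc; eexists; last exact: vc.
  by move=> i ltin /=; rewrite ltin c0// mulr1 addr0.
have [||v vL] := Vcpt (range L).
- move=> _ [n _ <-]; exists (s n), (W n); split => //.
  exists (W n); last by rewrite setTI.
  apply: (open_sub_closed linU openU) => // u Uu.
  by exists (fun=> 0) => //; exact: expands0.
- move=> D /= DL.
  (* Index each member of the finite family [D], with default 0 elsewhere. For the largest index
     [N], the point [s N] lies in all members: [s N - s n] has no coefficient below [n]. *)
  have /choice[h hP] : forall X, exists n, X \in D -> X = L n.
    move=> X; have [/DL|] := boolP (X \in D); last by exists 0%N.
    by rewrite inE => -[n _ <-]; exists n.
  pose N := \max_(X <- D) h X.
  exists (s N) => X /= XD; rewrite /L (hP _ XD) /=.
  have hN : (h X <= N)%N by exact: leq_bigmax_seq.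
  exists (s N - s (h X)); last by rewrite addrC subrK.
  have := expandsP linU (-1) (expands_sum linU e (h X) (fun=> 1))
    (expands_sum linU e N (fun=> 1)).
  rewrite scaleN1r addrC => sE; eexists; last exact: sE.
  by move=> i ltih /=; rewrite ltih (leq_trans ltih hN) mulN1r addNr.
have [c _ vc] : exists2 c : nat -> K, forall i, (i < 0)%N -> c i = 1
    & expands U e c v by apply: LP; apply: vL; exists 0%N.
(* The common point has a zero coefficient at some [N], while membership in [L N.+1], the first
   variety to constrain index [N], makes it 1. *)
have [N cN0] := expands_eventually0 linU free_e vc.
have [d d1 vd] : exists2 d : nat -> K, forall i, (i < N.+1)%N -> d i = 1
    & expands U e d v by apply: LP; apply: vL; exists N.+1.
have := expands_unique linU free_e vc vd N.
by rewrite cN0 d1// => /esym/eqP; rewrite oner_eq0.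
Qed.

(** * Vanishing of the entropy *)

Lemma entropy_at_eq0 (R : realType) {K : fieldType} {V : linTopType K}
    (phi : {linear V -> V}) (U : set V) d (f : 'I_d -> V) :
  linear_subspace U -> spans_mod U f -> entropy_at R phi U = 0%E.
Proof.
move=> linU span_f; apply/cvg_lim => //.
(* As [f] spans all of [V] modulo [U], the same [d] bounds the dimension for every trajectory. *)
apply: (@squeeze_cvge _ _ _ _ (cst 0%E) _
  (fun n => (n.+1%:R^-1 * d%:R)%:E)); last 2 first.
- exact: cvg_cst.
- apply: cvg_EFin; first exact: nearW.
  rewrite -[0 in X in _ --> X](mul0r d%:R); apply: cvgMl.
  exact: cvg_harmonic.
apply: nearW => n /=; rewrite mule_ge0 ?lee_fin ?quotient_dim_ge0//=.
by rewrite EFinM lee_pmul2l// ?lte_fin//; exact: quotient_dim_le span_f.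
Qed.

Lemma ent_eq0 (R : realType) {K : fieldType} {V : linTopType K}
    (phi : {linear V -> V}) : locally_linearly_compact V ->
  (forall U, lc_open_subspaces V U ->
    exists n (f : 'I_n -> V), spans_mod U f) ->
  ent R phi = 0%E.
Proof.
move=> [U0 lcU0] spanU; rewrite /ent.
(* The supremum of the empty set would be [-oo]; [U0] ensures that the value 0 is attained. *)
suff -> : [set entropy_at R phi U | U in lc_open_subspaces V] = [set 0%E].
  exact: ereal_sup1.
have H0 U : lc_open_subspaces V U -> entropy_at R phi U = 0%E.
  move=> lcU; have [n [f]] := spanU _ lcU; apply: entropy_at_eq0.
  by have [] := lcU.
apply/seteqP; split => [_ [U /H0 <- <-]//|_ ->].
by exists U0 => //; exact: H0.
Qed.

Lemma linearly_compact_set0 {K : fieldType} {V : linTopType K} :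
  linearly_compact [set (0 : V)].
Proof.
move=> F FA _; exists 0 => L /FA[v [W [-> linW _ ->]]].
by exists 0; [exact: linear_subspace0|rewrite addr0].
Qed.

Lemma discrete_llc {K : fieldType} {V : lmodType K} :
  locally_linearly_compact (discrete_topology V).
Proof.
exists [set 0]; split; last exact: linearly_compact_set0.
  split=> [|a u v]; rewrite !inE //= => -> ->.
  by rewrite scaler0 addr0.
exact: discrete_open.
Qed.

Theorem corollary3p5 (R : realType) (K : fieldType) :
  (forall (V : linTopType K) (phi : {linear V -> V}),
     linearly_compact [set: V] -> continuous phi -> ent R phi = 0%E)
  /\
  (forall (V : vectType K)
     (phi : {linear discrete_topology V -> discrete_topology V}),
     ent R phi = 0%E).
Proof.
split=> [V phi Vcpt _|V phi].
  apply: ent_eq0 => [|U [linU openU _]]; first exact: linearly_compact_llc.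
  exact: linearly_compact_spans_mod.
apply: ent_eq0 => [|U [linU _ _]]; first exact: discrete_llc.
(* A basis of [V] expresses each vector with remainder 0, which lies in every subspace; linear
   compactness of [V] is bypassed. *)
pose b := vbasis (fullv : {vspace V}).
exists (\dim (fullv : {vspace V})), (fun i => b`_i) => v.
exists (fun i => coord b i v).
rewrite -(coord_vbasis (memvf v)) subrr; exact: linear_subspace0 linU.
Qed.
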